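(* Let $X$ be a $\mathbb{Q}$-factorial projective toric variety over $\mathbb{C}$, let $\alpha\in\operatorname{Pic}X$ be a very ample class, and let $$\varphi\colon X\hookrightarrow \mathbb{P}(H^0(X,\mathcal{O}(\alpha))^* )$$ be the morphism associated with the complete linear system $|\mathcal{O}(\alpha)|$. Fix a non-zero $F\in H^0(X,\mathcal{O}(\alpha))^*$. Then for any closed subscheme $R\hookrightarrow X$ we have $$F\in\langle R\rangle \iff I(R)\subseteq F^\perp .$$
   Context: Let $\Sigma$ be the fan of $X$, with rays $\rho_1,\dots,\rho_r$ and torus-invariant prime divisors $D_{\rho_1},\dots,D_{\rho_r}$. ($\mathbb{Q}$-factorial means that $\Sigma$ is simplicial.) The Cox ring of $X$ is $S=\mathbb{C}[x_1,\dots,x_r]$, graded by $\operatorname{Cl}X$ via $\deg x_i=[D_{\rho_i}]$; for every $\beta\in\operatorname{Cl}X$ there is the standard identification $S_\beta\cong H^0(X,\mathcal{O}(\beta))$, where $\mathcal{O}(\beta)$ is the rank one reflexive sheaf of the class $\beta$. Let $T=\mathbb{C}[y_1,\dots,y_r]$, graded by $\operatorname{Cl}X$ via $\deg y_i=[D_{\rho_i}]$. $T$ is an $S$-module through the contraction action $\lrcorner$ determined by: $x_i\lrcorner y_1^{b_1}\cdots y_r^{b_r}$ equals $y_1^{b_1}\cdots y_i^{b_i-1}\cdots y_r^{b_r}$ if $b_i>0$, and $0$ otherwise. The pairing $S_\alpha\times T_\alpha\to T_0=\mathbb{C}$, $(g,F)\mapsto g\lrcorner F$, is perfect and identifies $H^0(X,\mathcal{O}(\alpha))^*$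 with $T_\alpha$. For $F\in T_\alpha$, $F^\perp=\{g\in S: g\lrcorner F=0\}$. For a closed subscheme $R\hookrightarrow X$ with ideal sheaf $\mathcal{I}_R$, the ideal $I(R)\subseteq S$ is the image of the map $$\bigoplus_{\beta\in\operatorname{Cl}X}H^0(X,\mathcal{I}_R\otimes\mathcal{O}(\beta))\to\bigoplus_{\beta\in\operatorname{Cl}X}H^0(X,\mathcal{O}(\beta))=S$$ induced by $\mathcal{I}_R\hookrightarrow\mathcal{O}_X$. $\mathbb{P}(W)$ is the space of lines in $W$. $\langle R\rangle$ is the linear span of $R$, i.e. the smallest projective linear subspace of $\mathbb{P}(H^0(X,\mathcal{O}(\alpha))^* )$ through which the inclusion $R\hookrightarrow X\xrightarrow{\varphi}\mathbb{P}(H^0(X,\mathcal{O}(\alpha))^* )$ factors, and $F\in\langle R\rangle$ means that the point $[F]$ lies in $\langle R\rangle$. *)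

(* Defs.v *)
From HB Require Import structures.
From mathcomp Require Import all_boot all_order all_algebra.
From mathcomp Require Import fraction.
From mathcomp Require Import reals complex mpoly.

Set Implicit Arguments.
Unset Strict Implicit.
Unset Printing Implicit Defensive.

Import Order.TTheory GRing.Theory Num.Theory.
Local Open Scope ring_scope.

(** * Fans

    N = M = Z^n with the dot product as pairing.  A cone of the fan is given by
    the set of indices of its rays; the rays are the rows of a matrix. *)

Definition cone (R : realType) n r (U : 'M[int]_(r, n)) (s : {set 'I_r})
    (v : 'rV[R]_n) : Prop :=
  exists c : 'rV[R]_r, [/\ forall i, 0 <= c 0 i,
                           forall i, i \notin s -> c 0 i = 0
                         & v = c *m map_mx intr U].

(* The i-th entry is <m, u_i>, so this is div(chi^m). *)
Definition divchi n r (U : 'M[int]_(r, n)) (m : 'rV[int]_n) : 'rV[int]_r :=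
  m *m U^T.

Definition is_face n r (U : 'M[int]_(r, n)) (t s : {set 'I_r}) : Prop :=
  exists m : 'rV[int]_n, (forall i, i \in s -> 0 <= divchi U m 0 i) /\
    t = [set i in s | divchi U m 0 i == 0].

Record fan (R : realType) (n r : nat) := Fan {
  rays : 'M[int]_(r, n);
  cones : {set {set 'I_r}};
  rays_primitive : forall i, \big[gcdn/0%N]_(j < n) `|rays i j|%N = 1%N;
  zero_cone : set0 \in cones;
  ray_cones : forall i, [set i] \in cones;
  strongly_convex : forall s (v : 'rV[R]_n), s \in cones ->
    cone rays s v -> cone rays s (- v) -> v = 0;
  face_cones : forall s t, s \in cones -> is_face rays t s -> t \in cones;
  cones_meet_face : forall s t, s \in cones -> t \in cones ->
    is_face rays (s :&: t) s;
  cones_meet : forall s t (v : 'rV[R]_n), s \in cones -> t \in cones ->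
    cone rays s v -> cone rays t v -> cone rays (s :&: t) v
}.

Definition simplicial R n r (X : fan R n r) : Prop :=
  forall s, s \in cones X -> forall c : 'rV[R]_r,
    (forall i, i \notin s -> c 0 i = 0) ->
    c *m map_mx intr (rays X) = 0 -> c = 0.

Definition complete_fan R n r (X : fan R n r) : Prop :=
  forall v : 'rV[R]_n, exists2 s, s \in cones X & cone (rays X) s v.

(** * Cox ring and its contraction module

    A class in Cl X = Z^r / div(M) is given by a torus-invariant divisor
    D = \sum_i D_i D_{rho_i} representing it.  Both S and T are [coxring R r]. *)

Notation coxring R r := {mpoly (complex R)[r]}.

Definition lin_equiv R n r (X : fan R n r) (D E : 'rV[int]_r) : Prop :=
  exists m, E = D + divchi (rays X) m.

Definition mdivisor r (b : 'X_{1..r}) : 'rV[int]_r := \row_i (b i)%:Z.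

Definition of_class R n r (X : fan R n r) (D : 'rV[int]_r) (b : 'X_{1..r}) :=
  lin_equiv X D (mdivisor b).

(* S_[D], and also T_[D] *)
Definition homogeneous R n r (X : fan R n r) (D : 'rV[int]_r) (g : coxring R r) :=
  forall b, b \in msupp g -> of_class X D b.

Definition contract_var (R : realType) r (i : 'I_r) (F : coxring R r) :
    coxring R r :=
  \sum_(b <- msupp F)
    F@_b *: (if (0 < b i)%N then 'X_[(b - U_(i))%MM] else 0).

Definition contract_mon (R : realType) r (a : 'X_{1..r}) (F : coxring R r) :
    coxring R r :=
  foldr (fun i => iter (a i) (contract_var i)) F (enum 'I_r).

Definition contract (R : realType) r (g F : coxring R r) : coxring R r :=
  \sum_(a <- msupp g) g@_a *: contract_mon a F.

(* For g in S_alpha, F in T_alpha, and X complete, [contract g F] is constant. *)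
Definition pairing (R : realType) r (g F : coxring R r) : complex R :=
  (contract g F)@_0%MM.

(** * Charts and sheaves

    The affine charts U_s (s a cone), their coordinate rings
    C[s^dual \cap M] and the sections of the sheaves O(D) all live in C[M].
    We realize C[M] inside the fraction field of S, by
    chi^m = \prod_i x_i^<m, u_i>; this is injective as soon as the rays span
    N_R, in particular when X is complete.  The standard identification
    H^0(X, O(D)) = S_[D] is then multiplication by x^D. *)

Notation coxfrac R r := {fraction (coxring R r)}.

Definition kconst (R : realType) r (c : complex R) : coxfrac R r :=
  tofrac (c%:MP).

Definition lmon (R : realType) r (e : 'rV[int]_r) : coxfrac R r :=
  \prod_i (tofrac ('X_i : coxring R r)) ^ (e 0 i).

Definition chi R n r (X : fan R n r) (m : 'rV[int]_n) : coxfrac R r :=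
  lmon R (divchi (rays X) m).

(* Gamma(U_s, O(D)), the span of the chi^m with <m, u_i> >= - D_i on s *)
Definition sections R n r (X : fan R n r) (D : 'rV[int]_r) (s : {set 'I_r})
    (f : coxfrac R r) : Prop :=
  exists l : seq (complex R * 'rV[int]_n),
    (forall p, p \in l ->
       forall i, i \in s -> 0 <= (D + divchi (rays X) p.2) 0 i) /\
    f = \sum_(p <- l) kconst r p.1 * chi X p.2.

Definition regular R n r (X : fan R n r) (s : {set 'I_r}) :
    coxfrac R r -> Prop := sections X 0 s.

(* The divisor of D is principal on each U_s, equal to div(chi^(-m)) there. *)
Definition cartier R n r (X : fan R n r) (D : 'rV[int]_r) : Prop :=
  forall s, s \in cones X -> exists m,
    forall i, i \in s -> divchi (rays X) m 0 i = - D 0 i.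

(** * Closed subschemes

    A quasi-coherent ideal sheaf is a family of ideals of the coordinate rings
    of the charts, compatible with the localizations at the faces; note that
    U_s \cap U_t is the chart of the common face s :&: t. *)

Record closed_subscheme R n r (X : fan R n r) := ClosedSubscheme {
  ideal : {set 'I_r} -> coxfrac R r -> Prop;
  ideal_regular : forall s, s \in cones X ->
    forall f, ideal s f -> regular X s f;
  ideal0 : forall s, s \in cones X -> ideal s 0;
  idealD : forall s, s \in cones X ->
    forall f g, ideal s f -> ideal s g -> ideal s (f + g);
  idealM : forall s, s \in cones X ->
    forall a f, regular X s a -> ideal s f -> ideal s (a * f);
  ideal_face : forall s t, s \in cones X -> is_face (rays X) t s ->
    forall f, ideal t f <->
      exists l : seq (coxfrac R r * coxfrac R r),
        (forall p, p \in l -> regular X t p.1 /\ ideal s p.2) /\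
        f = \sum_(p <- l) p.1 * p.2
}.

(* Equality in the tensor product over A of P and Q (A a subring, P and Q
   A-submodules of L) of the formal sums of pure tensors given by two lists. *)
Inductive tensor_eq (L : nzRingType) (A P Q : L -> Prop) :
    seq (L * L) -> seq (L * L) -> Prop :=
| teq_refl x : tensor_eq A P Q x x
| teq_sym x y : tensor_eq A P Q x y -> tensor_eq A P Q y x
| teq_trans x y z :
    tensor_eq A P Q x y -> tensor_eq A P Q y z -> tensor_eq A P Q x z
| teq_cat x x' y y' : tensor_eq A P Q x x' -> tensor_eq A P Q y y' ->
    tensor_eq A P Q (x ++ y) (x' ++ y')
| teq_comm x y : tensor_eq A P Q (x ++ y) (y ++ x)
| teq_0l q : Q q -> tensor_eq A P Q [:: (0, q)] [::]
| teq_Dl p p' q : P p -> P p' -> Q q ->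
    tensor_eq A P Q [:: (p + p', q)] [:: (p, q); (p', q)]
| teq_Dr p q q' : P p -> Q q -> Q q' ->
    tensor_eq A P Q [:: (p, q + q')] [:: (p, q); (p, q')]
| teq_scale a p q : A a -> P p -> Q q ->
    tensor_eq A P Q [:: (a * p, q)] [:: (p, a * q)].

(* Global sections of the (possibly not torsion-free) sheaf I_Z \otimes O(D) *)
Definition tensor_section R n r (X : fan R n r) (Z : closed_subscheme X)
    (D : 'rV[int]_r)
    (w : {set 'I_r} -> seq (coxfrac R r * coxfrac R r)) : Prop :=
  (forall s, s \in cones X -> forall p, p \in w s ->
     ideal Z s p.1 /\ sections X D s p.2) /\
  (forall s t, s \in cones X -> is_face (rays X) t s ->
     tensor_eq (regular X t) (ideal Z t) (sections X D t) (w s) (w t)).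

(* The image of H^0(X, I_Z \otimes O(D)) in H^0(X, O(D)) *)
Definition H0_image R n r (X : fan R n r) (Z : closed_subscheme X)
    (D : 'rV[int]_r) (f : coxfrac R r) : Prop :=
  exists2 w, tensor_section Z D w &
    forall s, s \in cones X -> f = \sum_(p <- w s) p.1 * p.2.

(* I(Z) *)
Definition cox_ideal R n r (X : fan R n r) (Z : closed_subscheme X)
    (g : coxring R r) : Prop :=
  exists l : seq ('rV[int]_r * coxfrac R r),
    (forall p, p \in l -> H0_image Z p.1 p.2) /\
    tofrac g = \sum_(p <- l) lmon R p.1 * p.2.

(** * The map to projective space

    P(W), W = H^0(X, O(D))^* = T_[D], is covered by the affine charts {x^b != 0}
    for the monomials x^b in S_[D] = W^*.  The torus-invariant open set of X
    where the section x^b does not vanish is the union of the U_s such that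
    b vanishes on s, and it is the preimage of the chart {x^b != 0}. *)

Definition nonvanishing r (b : 'X_{1..r}) (s : {set 'I_r}) : Prop :=
  forall i, i \in s -> b i = 0%N.

(* The pullback along phi of the coordinate function g / x^b *)
Definition coord_pullback (R : realType) r (b : 'X_{1..r}) (g : coxring R r) :
    coxfrac R r := tofrac g / tofrac 'X_[b].

(* The pullback along phi of the function f(g_1 / x^b, ..., g_k / x^b); all the
   functions on the chart are of this form. *)
Definition chart_pullback (R : realType) r (b : 'X_{1..r}) k
    (g : 'I_k -> coxring R r) (f : {mpoly (complex R)[k]}) : coxfrac R r :=
  mmap (@kconst R r) (fun j => coord_pullback b (g j)) f.

(* First clause: the linear system is base point free (the base locus is
   torus-invariant, so monomial sections suffice).  Second clause: phi is a
   closed immersion, that is, the preimage of each chart is affine (a nonempty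
   torus-invariant affine open set is some U_s) and the functions on it are
   pulled back from the chart. *)
Definition very_ample R n r (X : fan R n r) (D : 'rV[int]_r) : Prop :=
  (forall s, s \in cones X -> exists2 b, of_class X D b & nonvanishing b s) /\
  (forall b, of_class X D b -> exists s,
     [/\ s \in cones X,
         forall t, t \in cones X -> nonvanishing b t <-> is_face (rays X) t s
       & forall a, regular X s a ->
           exists k (g : 'I_k -> coxring R r) f,
             (forall j, homogeneous X D (g j)) /\ a = chart_pullback b g f]).

Definition projective R n r (X : fan R n r) : Prop :=
  complete_fan X /\ exists2 D, cartier X D & very_ample X D.

(** * Linear spans *)

(* V is a linear subspace of W, so that P(V) is a linear subspace of P(W). *)
Definition subspace R n r (X : fan R n r) (D : 'rV[int]_r)
    (V : coxring R r -> Prop) : Prop :=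
  [/\ forall F, V F -> homogeneous X D F, V 0,
      forall F G, V F -> V G -> V (F + G)
    & forall c F, V F -> V (c *: F)].

(* P(V) is the closed subscheme of P(W) cut out by the linear forms that vanish
   on V; Z -> P(W) factors through it when their pullbacks vanish on Z. *)
Definition factors_through R n r (X : fan R n r) (D : 'rV[int]_r)
    (Z : closed_subscheme X) (V : coxring R r -> Prop) : Prop :=
  forall g : coxring R r, homogeneous X D g -> (forall F, V F -> pairing g F = 0) ->
  forall s b, s \in cones X -> of_class X D b -> nonvanishing b s ->
    ideal Z s (coord_pullback b g).

Definition is_span R n r (X : fan R n r) (D : 'rV[int]_r)
    (Z : closed_subscheme X) (V : coxring R r -> Prop) : Prop :=
  [/\ subspace X D V, factors_through D Z V
    & forall V', subspace X D V' -> factors_through D Z V' ->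
        forall F, V F -> V' F].

Definition in_span R n r (X : fan R n r) (D : 'rV[int]_r)
    (Z : closed_subscheme X) (F : coxring R r) : Prop :=
  exists2 V, is_span D Z V & V F.

(* Main.v *)
Require Import Defs.
From HB Require Import structures.
From mathcomp Require Import all_boot all_order all_algebra.
From mathcomp Require Import fraction boolp.
From mathcomp Require Import reals complex mpoly.

(** Let L be the space of the linear forms g in S_alpha whose restriction to Z
    vanishes, that is, the image of H^0(X, I_Z(alpha)) in S_alpha.  A linear
    subspace P(V) contains Z exactly when V^perp is contained in L.  The fan is
    complete, so S_alpha is finite-dimensional ([finite_class]) and double
    annihilators for the perfect pairing of S_alpha with T_alpha are closed
    ([pairing_separation]); hence the span of Z is P(L^perp), and F lies in it
    if and only if F annihilates L ([in_spanP]).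

    It remains to compare L with the ideal I(Z), which lives in all degrees.

    On the one hand, L is contained in I(Z) ([vanishing_cox_ideal]).  A form g
    in L gives on each chart the pure tensor (g / x^b) (x) x^b, where x^b is a
    monomial of class alpha without zeros on the chart; two choices of x^b
    differ by a unit, so these tensors agree on overlaps and form a global
    section of the tensor product.  Since F annihilates L as soon as
    g . F = 0 for all g in I(Z), one implication follows.

    On the other hand, the coefficient of y^c in g . F is the pairing of x^c g
    with F ([contract_pairing]), so g . F = 0 means that F annihilates the
    component of class alpha of the ideal (g).  An element of I(Z) is a sum of
    homogeneous g, each coming from a section of I_Z (x) O(D).  Such a section
    is a genuine polynomial of class D ([H0_image_global]), and x^c g belongs to
    L when its class is alpha ([H0_image_vanishing]), while it pairs to zero
    with F for reasons of degree otherwise.  This gives the other implication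
    ([cox_ideal_contract]). *)

Set Implicit Arguments.
Unset Strict Implicit.
Unset Printing Implicit Defensive.

Import Order.TTheory GRing.Theory Num.Theory.
Local Open Scope ring_scope.

(** * The contraction pairing *)

Lemma contract_varE (R : realType) r (i : 'I_r) (F : coxring R r) c :
  (contract_var i F)@_c = F@_(c + U_(i)).
Proof.
rewrite /contract_var raddf_sum /=.
have H b : (F@_b *: (if (0 < b i)%N then 'X_[b - U_(i)] else 0))@_c
    = F@_b * (b == c + U_(i))%MM%:R.
  rewrite mcoeffZ; congr (_ * _); case: ifP => bi.
    rewrite mcoeffX; congr (_%:R); congr nat_of_bool.
    apply/eqP/eqP => [<-|->]; last by rewrite addmK.
    by rewrite submK // lep1mP -lt0n.
  rewrite mcoeff0; case: eqP => // bE; move: bi.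
  by rewrite bE mnmDE mnm1E eqxx addn1.
under eq_bigr do rewrite H.
have [cF|cF] := boolP ((c + U_(i))%MM \in msupp F).
  rewrite (bigD1_seq _ cF (msupp_uniq F)) /= eqxx mulr1 big1 ?addr0 //.
  by move=> b /negPf->; rewrite mulr0.
rewrite (memN_msupp_eq0 cF) big1_seq // => b /= bF.
case: eqP => [bE|_]; last by rewrite mulr0.
by rewrite -bE bF in cF.
Qed.

Lemma contract_monE (R : realType) r (a : 'X_{1..r}) (F : coxring R r) c :
  (contract_mon a F)@_c = F@_(c + a).
Proof.
have Hit i k (G : coxring R r) d :
    (iter k (contract_var i) G)@_d = G@_(d + U_(i) *+ k).
  elim: k d => [|k IH] d /=; first by rewrite mulm0n addm0.
  by rewrite contract_varE IH mulmS addmA.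
have Hf (e : seq 'I_r) d :
    (foldr (fun i => iter (a i) (contract_var i)) F e)@_d
    = F@_(d + \sum_(i <- e) U_(i) *+ a i).
  elim: e d => [|i e IH] d /=; first by rewrite big_nil addm0.
  by rewrite Hit IH big_cons addmA.
by rewrite /contract_mon Hf big_enum /= -multinomUE_id.
Qed.

Lemma contractE (R : realType) r (g F : coxring R r) c :
  (contract g F)@_c = \sum_(a <- msupp g) g@_a * F@_(c + a).
Proof.
rewrite /contract raddf_sum /=; apply: eq_bigr => a _.
by rewrite mcoeffZ contract_monE.
Qed.

Lemma pairingE (R : realType) r (g F : coxring R r) :
  pairing g F = \sum_(a <- msupp g) g@_a * F@_a.
Proof. by rewrite /pairing contractE; under eq_bigr do rewrite add0m. Qed.

Lemma pairingC (R : realType) r (g F : coxring R r) :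
  pairing g F = pairing F g.
Proof.
have H (p q : coxring R r) :
    pairing p q = \sum_(a <- [seq a <- msupp p | a \in msupp q]) p@_a * q@_a.
  rewrite pairingE big_filter (bigID (mem (msupp q))) /= [X in _ + X]big1.
    by rewrite addr0.
  by move=> a /memN_msupp_eq0->; rewrite mulr0.
rewrite (H g F) (H F g) (perm_big [seq a <- msupp F | a \in msupp g]) /=.
  by apply: eq_bigr => a _; rewrite mulrC.
apply: uniq_perm; rewrite ?filter_uniq ?msupp_uniq // => a.
by rewrite !mem_filter andbC.
Qed.

Lemma pairingDr (R : realType) r (g F G : coxring R r) :
  pairing g (F + G) = pairing g F + pairing g G.
Proof.
rewrite !pairingE -big_split; apply: eq_bigr => a _ /=.
by rewrite mcoeffD mulrDr.
Qed.

Lemma pairingZr (R : realType) r (g F : coxring R r) c :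
  pairing g (c *: F) = c * pairing g F.
Proof.
rewrite !pairingE mulr_sumr; apply: eq_bigr => a _.
by rewrite mcoeffZ mulrCA.
Qed.

Lemma pairing0r (R : realType) r (g : coxring R r) : pairing g 0 = 0.
Proof. by rewrite -(scale0r (0 : coxring R r)) pairingZr mul0r. Qed.

Lemma pairingDl (R : realType) r (g h F : coxring R r) :
  pairing (g + h) F = pairing g F + pairing h F.
Proof. by rewrite pairingC pairingDr !(pairingC F). Qed.

Lemma pairingZl (R : realType) r (g F : coxring R r) c :
  pairing (c *: g) F = c * pairing g F.
Proof. by rewrite pairingC pairingZr (pairingC F). Qed.

Lemma pairing_suml (R : realType) r (I : Type) (l : seq I)
    (G : I -> coxring R r) F :
  pairing (\sum_(i <- l) G i) F = \sum_(i <- l) pairing (G i) F.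
Proof.
elim: l => [|i l IH]; first by rewrite !big_nil pairingC pairing0r.
by rewrite !big_cons pairingDl IH.
Qed.

Lemma pairingXl (R : realType) r (b : 'X_{1..r}) (F : coxring R r) :
  pairing 'X_[b] F = F@_b.
Proof. by rewrite pairingE msuppX big_seq1 mcoeffX eqxx mul1r. Qed.

(** This reduces the vanishing of a contraction, which involves all degrees,
    to the pairing between S_alpha and T_alpha. *)
Lemma contract_pairing (R : realType) r (g F : coxring R r) c :
  (contract g F)@_c = pairing ('X_[c] * g) F.
Proof.
rewrite contractE {3}(mpolyE g) mulr_sumr pairing_suml; apply: eq_bigr => a _.
by rewrite -scalerAr pairingZl -mpolyXD pairingXl.
Qed.

Lemma sub_msuppD r (K : nzRingType) (A : {pred 'X_{1..r}})
    (p q : {mpoly K[r]}) :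
  {subset msupp p <= A} -> {subset msupp q <= A} -> {subset msupp (p + q) <= A}.
Proof.
by move=> pA qA b /msuppD_le; rewrite mem_cat => /orP[/pA|/qA].
Qed.

(** A finite-dimensional space is the annihilator of its annihilator.  The
    induction is on the monomials available: if V contains some p0 with
    coefficient 1 at the new monomial a, then p |-> p - p_a p0 projects onto
    the smaller space, and a functional y found there is extended to the
    monomial a in the only way that makes it kill p0.  If all of V vanishes at
    a, either the coordinate at a separates x from V or x also lives in the
    smaller space. *)
Lemma pairing_separation (R : realType) r (A : seq 'X_{1..r})
    (V : coxring R r -> Prop) (x : coxring R r) :
    (forall p, V p -> {subset msupp p <= A}) ->
    V 0 -> (forall p q, V p -> V q -> V (p + q)) ->
    (forall c p, V p -> V (c *: p)) ->
    {subset msupp x <= A} -> ~ V x ->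
  exists y, [/\ {subset msupp y <= A}, forall p, V p -> pairing y p = 0
              & pairing y x <> 0].
Proof.
elim: A V x => [|a A IH] V x VA V0 VD VZ xA Vx.
  suff x0 : x = 0 by rewrite x0 in Vx.
  apply/mpolyP => b; rewrite mcoeff0 memN_msupp_eq0 //.
  by apply/negP => /xA.
have supA (p : coxring R r) :
    {subset msupp p <= a :: A} -> p@_a = 0 -> {subset msupp p <= A}.
  move=> pA pa b bp; have := pA b bp; rewrite inE => /orP[/eqP bE|//].
  by rewrite bE mcoeff_msupp pa eqxx in bp.
(* An element of V with a nonzero coefficient at a can be scaled to have 1. *)
have [[p0 [Vp0 p0a]]|noa] := pselect (exists p, V p /\ p@_a = 1); last first.
  have Va p : V p -> p@_a = 0.
    move=> Vp; apply: contrapT => /eqP pa; apply: noa.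
    by exists ((p@_a)^-1 *: p); rewrite mcoeffZ mulVf //; split=> //; apply: VZ.
  have [xa|xa] := eqVneq (x@_a) 0.
    have [|y [yA yV yx]] := IH V x _ V0 VD VZ (supA x xA xa) Vx.
      by move=> p Vp; apply: supA; [apply: VA | apply: Va].
    by exists y; split=> // b /yA; rewrite inE orbC => ->.
  exists 'X_[a]; split; last by rewrite pairingXl; apply/eqP.
    by move=> b; rewrite msuppX !inE => /eqP->; rewrite eqxx.
  by move=> p /Va; rewrite pairingXl.
pose V' p := V p /\ p@_a = 0.
have red (p : coxring R r) : {subset msupp p <= a :: A} ->
    {subset msupp (p - p@_a *: p0) <= a :: A} /\ (p - p@_a *: p0)@_a = 0.
  move=> pA; rewrite mcoeffB mcoeffZ p0a mulr1 subrr; split=> //.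
  apply: sub_msuppD => // b; rewrite (perm_mem (msuppN _)) => /msuppZ_le.
  exact: VA.
have [x'A x'a] := red x xA.
have [||||||y [yA yV yx]] := IH V' (x - x@_a *: p0).
- by move=> p [Vp pa]; apply: supA => //; apply: VA.
- by rewrite /V' mcoeff0.
- move=> p q [Vp pa] [Vq qa]; split; first exact: VD.
  by rewrite mcoeffD pa qa addr0.
- by move=> c p [Vp pa]; split; [exact: VZ | rewrite mcoeffZ pa mulr0].
- exact: supA.
- case=> Vx' _; apply: Vx; rewrite -(subrK (x@_a *: p0) x).
  by apply: VD => //; apply: VZ.
have yE p : pairing (y - pairing y p0 *: 'X_[a]) p
            = pairing y (p - p@_a *: p0).
  rewrite -!scaleNr pairingDl pairingZl pairingXl pairingDr pairingZr.
  by rewrite mulNr mulrC -mulNr.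
exists (y - pairing y p0 *: 'X_[a]); split; last by rewrite yE.
  apply: sub_msuppD => b; first by move/yA; rewrite inE orbC => ->.
  by rewrite (perm_mem (msuppN _)) => /msuppZ_le; rewrite msuppX !inE => ->.
move=> p Vp; have [_ p'a] := red p (VA p Vp).
rewrite yE; apply: yV; split=> //.
by rewrite -scaleNr; apply: VD => //; apply: VZ.
Qed.

(** * Divisor classes and homogeneous forms *)

Lemma divchiD n r (U : 'M[int]_(r, n)) m m' :
  divchi U (m + m') = divchi U m + divchi U m'.
Proof. exact: mulmxDl. Qed.

Lemma divchiN n r (U : 'M[int]_(r, n)) m : divchi U (- m) = - divchi U m.
Proof. exact: mulNmx. Qed.

Lemma divchi0 n r (U : 'M[int]_(r, n)) : divchi U 0 = 0.
Proof. exact: mul0mx. Qed.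

Lemma mdivisorD r (b c : 'X_{1..r}) :
  mdivisor (b + c)%MM = mdivisor b + mdivisor c.
Proof. by apply/rowP => i; rewrite !mxE mnmDE PoszD. Qed.

Lemma lin_equiv_sym R n r (X : fan R n r) D E :
  lin_equiv X D E -> lin_equiv X E D.
Proof. by case=> m ->; exists (- m); rewrite divchiN addrK. Qed.

Lemma lin_equiv_trans R n r (X : fan R n r) D E G :
  lin_equiv X D E -> lin_equiv X E G -> lin_equiv X D G.
Proof. by case=> m -> [m' ->]; exists (m + m'); rewrite divchiD addrA. Qed.

Lemma lin_equivDr R n r (X : fan R n r) D E G :
  lin_equiv X D E -> lin_equiv X (D + G) (E + G).
Proof. by case=> m ->; exists m; rewrite addrAC. Qed.

Lemma homogeneous0 R n r (X : fan R n r) D : homogeneous X D (0 : coxring R r).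
Proof. by move=> b; rewrite msupp0. Qed.

Lemma homogeneousD R n r (X : fan R n r) D (g h : coxring R r) :
  homogeneous X D g -> homogeneous X D h -> homogeneous X D (g + h).
Proof. by move=> gD hD b /msuppD_le; rewrite mem_cat => /orP[/gD|/hD]. Qed.

Lemma homogeneousZ R n r (X : fan R n r) D c (g : coxring R r) :
  homogeneous X D g -> homogeneous X D (c *: g).
Proof. by move=> gD b /msuppZ_le /gD. Qed.

Lemma homogeneousX R n r (X : fan R n r) D b :
  of_class X D b -> homogeneous X D ('X_[b] : coxring R r).
Proof. by move=> bD c /[!msuppX] /[!inE] /eqP->. Qed.

Lemma homogeneousMX R n r (X : fan R n r) D c (g : coxring R r) :
  homogeneous X D g -> homogeneous X (D + mdivisor c) ('X_[c] * g).
Proof.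
move=> gD a; rewrite mulrC (perm_mem (msuppMX _ _)) => /mapP[b /gD bD ->].
by rewrite addmC /of_class mdivisorD; apply: lin_equivDr.
Qed.

Lemma homogeneous_equiv R n r (X : fan R n r) D E (g : coxring R r) :
  lin_equiv X D E -> homogeneous X E g -> homogeneous X D g.
Proof. by move=> DE gE b /gE; apply: lin_equiv_trans. Qed.

Lemma homogeneous_sum R n r (X : fan R n r) D (I : eqType) (l : seq I)
    (g : I -> coxring R r) :
  (forall i, i \in l -> homogeneous X D (g i)) ->
  homogeneous X D (\sum_(i <- l) g i).
Proof.
move=> gD; rewrite big_seq.
apply: (big_ind (homogeneous X D)) => [|p q|i /gD//]; first exact: homogeneous0.
exact: homogeneousD.
Qed.

(** In a complete fan the vector - \sum_i u_i lies in some cone, which gives a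
    relation \sum_i w_i u_i = 0 with all w_i >= 1.  The weighted degree
    \sum_i w_i b_i is then constant on the class of D, and it bounds the degree
    of x^b. *)
Lemma finite_class (R : realType) n r (X : fan R n r) (D : 'rV[int]_r) :
  complete_fan X ->
  exists A : seq 'X_{1..r}, forall b, of_class X D b <-> b \in A.
Proof.
move=> Xc.
pose U := map_mx intr (rays X) : 'M[R]_(r, n).
have [s _ [c [c0 _ cE]]] := Xc (- (const_mx 1 *m U)).
pose w := const_mx 1 + c : 'rV[R]_r.
have wU : w *m U = 0 by rewrite mulmxDl -cE subrr.
pose C := \sum_i w 0 i * (D 0 i)%:~R.
have degC b : of_class X D b -> (mdeg b)%:R <= C.
  case=> m bE.
  have -> : C = \sum_i w 0 i * (b i)%:R.
    have zE : \sum_i w 0 i * (divchi (rays X) m 0 i)%:~R = 0.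
      transitivity ((w *m U *m (map_mx intr m)^T) 0 0); last first.
        by rewrite wU mul0mx mxE.
      rewrite -mulmxA mxE; apply: eq_bigr => i _; congr (_ * _).
      rewrite /divchi mxE rmorph_sum [RHS]mxE; apply: eq_bigr => j _ /=.
      by rewrite !mxE rmorphM mulrC.
    rewrite -[LHS]addr0 -[X in _ + X]zE -big_split; apply: eq_bigr => i _ /=.
    rewrite -mulrDr -rmorphD /=; congr (_ * _).
    by rewrite -[RHS]/((b i)%:Z%:~R); move/rowP/(_ i): bE; rewrite !mxE => ->.
  rewrite mdegE natr_sum; apply: ler_sum => i _.
  by rewrite ler_peMl ?ler0n // !mxE lerDl.
exists [seq b <- [seq val x | x : 'X_{1..r < Num.bound C}]
         | `[< of_class X D b >]].
move=> b; rewrite mem_filter; split=> [bD|/andP[/asboolP]//].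
apply/andP; split; first exact/asboolP.
have bC : (mdeg b < Num.bound C)%N.
  rewrite -(ltr_nat R); apply: le_lt_trans (degC b bD) _.
  by apply: archi_boundP; apply: le_trans (degC b bD).
by apply/mapP; exists (BMultinom bC); rewrite ?mem_enum.
Qed.

(** * Laurent monomials and sections over the charts *)

Lemma tofracX_neq0 (R : realType) r (b : 'X_{1..r}) :
  tofrac ('X_[b] : coxring R r) != 0.
Proof.
rewrite tofrac_eq0; apply/eqP => /mpolyP/(_ b)/eqP.
by rewrite mcoeffX mcoeff0 eqxx oner_eq0.
Qed.

Lemma lmonD (R : realType) r (d e : 'rV[int]_r) :
  lmon R (d + e) = lmon R d * lmon R e.
Proof.
rewrite -big_split; apply: eq_bigr => i _ /=.
by rewrite mxE expfzDr // tofracX_neq0.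
Qed.

Lemma lmon0 (R : realType) r : lmon R (0 : 'rV[int]_r) = 1.
Proof. by apply: big1 => i _; rewrite mxE expr0z. Qed.

Lemma lmon_mdivisor (R : realType) r (b : 'X_{1..r}) :
  lmon R (mdivisor b) = tofrac 'X_[b].
Proof.
rewrite mpolyXE_id rmorph_prod; apply: eq_bigr => i _ /=.
by rewrite mxE rmorphXn.
Qed.

Lemma lmonBX (R : realType) r (e : 'rV[int]_r) (b : 'X_{1..r}) :
  lmon R (e - mdivisor b) = lmon R e / tofrac 'X_[b].
Proof.
rewrite -[in RHS](subrK (mdivisor b) e) [in RHS]lmonD lmon_mdivisor mulfK //.
exact: tofracX_neq0.
Qed.

Lemma lmonK (R : realType) r (e : 'rV[int]_r) (f : coxfrac R r) :
  lmon R e * (lmon R (- e) * f) = f.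
Proof. by rewrite mulrA -lmonD subrr lmon0 mul1r. Qed.

Lemma chiD (R : realType) n r (X : fan R n r) m m' :
  chi X (m + m') = chi X m * chi X m'.
Proof. by rewrite /chi divchiD lmonD. Qed.

Lemma kconstM (R : realType) r (c d : complex R) :
  kconst r (c * d) = kconst r c * kconst r d.
Proof. by rewrite /kconst mpolyCM tofracM. Qed.

Section Sections.
Variables (R : realType) (n r : nat) (X : fan R n r).
Implicit Types (D E : 'rV[int]_r) (s : {set 'I_r}) (f g : coxfrac R r).

Lemma sections0 D s : sections X D s 0.
Proof. by exists [::]; rewrite big_nil. Qed.

Lemma sectionsD D s f g :
  sections X D s f -> sections X D s g -> sections X D s (f + g).
Proof.
case=> l [ls ->] [l' [ls' ->]]; exists (l ++ l'); rewrite big_cat; split=> //.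
by move=> p; rewrite mem_cat => /orP[/ls|/ls'].
Qed.

Lemma sections_sum (I : eqType) (l : seq I) (f : I -> coxfrac R r) D s :
  (forall i, i \in l -> sections X D s (f i)) ->
  sections X D s (\sum_(i <- l) f i).
Proof.
move=> fs; rewrite big_seq.
apply: (big_ind (sections X D s)) => [|f' g'|i /fs//]; first exact: sections0.
exact: sectionsD.
Qed.

Lemma sections_monomial D s c m :
    (forall i, i \in s -> 0 <= (D + divchi (rays X) m) 0 i) ->
  sections X D s (kconst r c * chi X m).
Proof.
by move=> ms; exists [:: (c, m)]; rewrite big_seq1; split=> // p /[!inE] /eqP->.
Qed.

Lemma sections_chi D s m :
    (forall i, i \in s -> 0 <= (D + divchi (rays X) m) 0 i) ->
  sections X D s (chi X m).
Proof.
by move=> /(sections_monomial 1); rewrite /kconst mpolyC1 tofrac1 mul1r.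
Qed.

Lemma sectionsM D E s f g :
  sections X D s f -> sections X E s g -> sections X (D + E) s (f * g).
Proof.
case=> l [ls ->] [l' [ls' ->]]; rewrite mulr_suml.
apply: sections_sum => p pl; rewrite mulr_sumr; apply: sections_sum => q ql.
rewrite mulrACA -kconstM -chiD; apply: sections_monomial => i si.
by rewrite divchiD addrACA mxE addr_ge0 ?ls ?ls'.
Qed.

Lemma regular_kconst s c : regular X s (kconst r c).
Proof.
rewrite -[kconst r c]mulr1.
have -> : 1 = chi X 0 by rewrite /chi divchi0 lmon0.
by apply: sections_monomial => i _; rewrite divchi0 addr0 mxE.
Qed.

End Sections.

Lemma face_sub n r (U : 'M[int]_(r, n)) t s i :
  is_face U t s -> i \in t -> i \in s.
Proof. by case=> m [_ ->]; rewrite inE => /andP[]. Qed.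

(** * Linear spans *)

(** The subspace L of S_[D]: the forms g on P(T_[D]) that restrict to zero
    on Z. *)
Definition vanishing_form R n r (X : fan R n r) (Z : closed_subscheme X)
    (D : 'rV[int]_r) (g : coxring R r) : Prop :=
  homogeneous X D g /\
  forall s b, s \in cones X -> of_class X D b -> nonvanishing b s ->
    ideal Z s (coord_pullback b g).

Section Span.
Variables (R : realType) (n r : nat) (X : fan R n r) (Z : closed_subscheme X).
Variable (D : 'rV[int]_r).

Lemma vanishing_form0 : vanishing_form Z D 0.
Proof.
split=> [|s b sX _ _]; first exact: homogeneous0.
by rewrite /coord_pullback tofrac0 mul0r; apply: ideal0.
Qed.

Lemma vanishing_formD g h :
  vanishing_form Z D g -> vanishing_form Z D h -> vanishing_form Z D (g + h).
Proof.
case=> gD gZ [hD hZ]; split=> [|s b sX bD bs]; first exact: homogeneousD.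
rewrite /coord_pullback tofracD mulrDl.
by apply: idealD; [|apply: gZ|apply: hZ].
Qed.

Lemma vanishing_formZ c g : vanishing_form Z D g -> vanishing_form Z D (c *: g).
Proof.
case=> gD gZ; split=> [|s b sX bD bs]; first exact: homogeneousZ.
rewrite /coord_pullback -mul_mpolyC tofracM -mulrA.
by apply: idealM => //; [apply: regular_kconst | apply: gZ].
Qed.

(** The span of Z is the annihilator of the forms that vanish on Z.  Separation
    is used twice: it shows that a form killing this annihilator vanishes on Z,
    and that any V through which Z factors contains the annihilator. *)
Lemma in_spanP F : complete_fan X -> homogeneous X D F ->
  in_span D Z F <-> forall g, vanishing_form Z D g -> pairing g F = 0.
Proof.
move=> Xc FD; have [A AP] := finite_class D Xc.
have homA (p : coxring R r) : homogeneous X D p -> {subset msupp p <= A}.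
  by move=> pD b /pD /AP.
have Ahom (p : coxring R r) : {subset msupp p <= A} -> homogeneous X D p.
  by move=> pA b /pA /AP.
pose V0 (G : coxring R r) := homogeneous X D G /\
  forall g, vanishing_form Z D g -> pairing g G = 0.
have V0span : is_span D Z V0.
  split.
  - split.
    + by move=> G [].
    + by split=> [|g _]; [exact: homogeneous0 | exact: pairing0r].
    + move=> G H [GD GV] [HD HV]; split=> [|g gZ]; first exact: homogeneousD.
      by rewrite pairingDr GV // HV // addr0.
    + move=> c G [GD GV]; split=> [|g gZ]; first exact: homogeneousZ.
      by rewrite pairingZr GV // mulr0.
  - move=> g gD gV0.
    suff [_ gZ] : vanishing_form Z D g by exact: gZ.
    apply: contrapT => ngZ.
    have [||||||y [yA yZ]] := @pairing_separation R r A (vanishing_form Z D) g.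
    + by move=> p [/homA].
    + exact: vanishing_form0.
    + exact: vanishing_formD.
    + exact: vanishing_formZ.
    + exact: homA.
    + by [].
    apply; rewrite pairingC; apply: gV0.
    by split=> [|p /yZ]; [exact: Ahom | rewrite pairingC].
  - move=> V [VD V00 Vadd Vscale] VZ G [GD GV]; apply: contrapT => nVG.
    have [||||||y [yA yV]] := @pairing_separation R r A V G => //.
    + by move=> p /VD /homA.
    + exact: homA.
    by apply; apply: GV; split; [exact: Ahom | apply: VZ => //; exact: Ahom].
split=> [[V [_ _ Vmin] VF]|FZ]; last by exists V0.
have [V0sub V0Z _] := V0span.
by have [] := Vmin V0 V0sub V0Z F VF.
Qed.

End Span.

(** * Global sections *)

(** On the chart U_s a section of O(D) has poles only along the divisors outside
    s, so multiplying by a monomial in those variables makes it a polynomial. *)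
Lemma sections_clear (R : realType) n r (X : fan R n r) D s (f : coxfrac R r) :
    sections X D s f ->
  exists (N : 'X_{1..r}) (Q : coxring R r),
    [/\ nonvanishing N s, homogeneous X (D + mdivisor N) Q
      & tofrac Q = tofrac 'X_[N] * (lmon R D * f)].
Proof.
case=> l [ls ->].
(* Outside s any bound on the exponents will do; the sum of their absolute
   values is one. *)
pose N : 'X_{1..r} := [multinom
  (if i \in s then 0
   else \sum_(p <- l) `|(D + divchi (rays X) p.2)%R ord0 i|)%N | i < r].
pose e (p : complex R * 'rV[int]_n) := D + divchi (rays X) p.2 + mdivisor N.
pose b p : 'X_{1..r} := [multinom `|e p ord0 i|%N | i < r].
have bE p : p \in l -> mdivisor (b p) = e p.
  move=> pl; apply/rowP => i; rewrite mxE mnmE gez0_abs //.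
  rewrite [e p 0 i]mxE [mdivisor N 0 i]mxE mnmE.
  case: ifP => si; first by rewrite addr0 ls.
  rewrite (big_rem _ pl) /= PoszD addrA addr_ge0 //.
  by rewrite abszE addrC -[X in _ + X]opprK subr_ge0 -normrN ler_norm.
exists N, (\sum_(p <- l) p.1 *: 'X_[b p]); split.
- by move=> i si; rewrite mnmE si.
- apply: homogeneous_sum => p pl; apply: homogeneousZ; apply: homogeneousX.
  by exists p.2; rewrite bE // /e addrAC.
rewrite rmorph_sum !mulr_sumr big_seq [RHS]big_seq.
apply: eq_bigr => p pl /=; rewrite -mul_mpolyC tofracM -/(kconst r p.1).
rewrite -!lmon_mdivisor bE // /e !lmonD -/(chi X p.2).
by rewrite [RHS]mulrC [lmon R D * (_ * _)]mulrCA -[RHS]mulrA.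
Qed.

(** H^0(X, O(D)) = S_[D].  The denominator x^N obtained on the torus is
    compared, for each ray i, with a denominator x^M on the chart of that ray,
    where M_i = 0: in x^M P = x^N Q the variable x_i occurs on the left only
    through P, so x_i^(N_i) divides P. *)
Lemma global_sections (R : realType) n r (X : fan R n r) D (f : coxfrac R r) :
    (forall s, s \in cones X -> sections X D s f) ->
  exists2 G : coxring R r, homogeneous X D G & tofrac G = lmon R D * f.
Proof.
move=> fX.
have [N [P [_ PD PE]]] := sections_clear (fX _ (zero_cone X)).
have NP b : b \in msupp P -> (N <= b)%MM.
  move=> bP; apply/mnm_lepP => i.
  have [M [Q [Mi _ QE]]] := sections_clear (fX _ (ray_cones X i)).
  have MPQ : P * 'X_[M] = Q * 'X_[N].
    by apply/eqP; rewrite -tofrac_eq !tofracM PE QE mulrC mulrCA mulrC.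
  have : (M + b)%MM \in msupp (Q * 'X_[N]).
    by rewrite -MPQ mcoeff_msupp mcoeffMX -mcoeff_msupp.
  rewrite (perm_mem (msuppMX _ _)) => /mapP[c _ /mnmP/(_ i)].
  by rewrite !mnmDE (Mi i) ?inE // add0n => ->; rewrite leq_addr.
have bE b : b \in msupp P -> mdivisor b = mdivisor (b - N)%MM + mdivisor N.
  by move=> /NP Nb; rewrite -mdivisorD submK.
exists (\sum_(b <- msupp P) P@_b *: 'X_[b - N]).
  apply: homogeneous_sum => b bP; apply: homogeneousZ; apply: homogeneousX.
  have := lin_equivDr (- mdivisor N) (PD b bP).
  by rewrite (bE b bP) !addrK.
apply: (@mulfI _ (tofrac 'X_[N])); first exact: tofracX_neq0.
rewrite -PE -tofracM; congr tofrac.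
rewrite [RHS]mpolyE mulr_sumr big_seq [RHS]big_seq; apply: eq_bigr => b bP.
by rewrite -scalerAr -mpolyXD addmC submK // NP.
Qed.

Lemma H0_image_global (R : realType) n r (X : fan R n r)
    (Z : closed_subscheme X) D (f : coxfrac R r) :
    H0_image Z D f ->
  exists2 G : coxring R r, homogeneous X D G & tofrac G = lmon R D * f.
Proof.
case=> w [wZ _] fE; apply: global_sections => s sX; rewrite (fE s sX).
apply: sections_sum => p pw; have [pZ pD] := wZ s sX p pw.
by rewrite -[D]add0r; apply: sectionsM => //; apply: ideal_regular pZ.
Qed.

(** * Comparison of the vanishing forms with the ideal I(Z) *)

Lemma ideal_sum R n r (X : fan R n r) (Z : closed_subscheme X) s (I : eqType)
    (l : seq I) (f : I -> coxfrac R r) : s \in cones X ->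
  (forall i, i \in l -> ideal Z s (f i)) -> ideal Z s (\sum_(i <- l) f i).
Proof.
move=> sX fZ; rewrite big_seq.
apply: (big_ind (ideal Z s)) => [|f' g'|i /fZ//]; first exact: ideal0.
exact: idealD.
Qed.

(** On a chart where x^b has no zeros, multiplication by x^(c + D - b) maps
    sections of O(D) to regular functions, so it maps I_Z O(D) into I_Z. *)
Lemma H0_image_vanishing (R : realType) n r (X : fan R n r)
    (Z : closed_subscheme X) D E (f : coxfrac R r) (G : coxring R r) c :
    H0_image Z D f -> homogeneous X D G -> tofrac G = lmon R D * f ->
    lin_equiv X E (mdivisor c + D) ->
  vanishing_form Z E ('X_[c] * G).
Proof.
case=> w [wZ _] fE GD GE Ec; split.
  by apply: homogeneous_equiv Ec _; rewrite addrC; apply: homogeneousMX.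
move=> s b sX Eb bs.
have [m mE] : lin_equiv X (mdivisor b) (mdivisor c + D).
  exact: lin_equiv_trans (lin_equiv_sym Eb) Ec.
have -> : coord_pullback b ('X_[c] * G) = chi X m * f.
  rewrite /chi -[divchi _ m](addKr (mdivisor b)) -mE addrC lmonBX lmonD.
  by rewrite lmon_mdivisor /coord_pullback tofracM GE mulrA [RHS]mulrAC.
rewrite (fE s sX) mulr_sumr; apply: ideal_sum => // p pw.
have [pZ pD] := wZ s sX p pw; rewrite mulrCA [p.1 * _]mulrC.
apply: idealM => //.
rewrite /regular -[0](addNr D); apply: sectionsM pD.
apply: sections_chi => i si.
have -> : - D + divchi (rays X) m = mdivisor c - mdivisor b.
  have -> : divchi (rays X) m = mdivisor c + D - mdivisor b.
    by rewrite mE addrC addKr.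
  by rewrite addrC addrAC addrK.
by rewrite !mxE (bs i si) subr0.
Qed.

(** Let x^(b s) be a monomial of class D without zeros on U_s, so that
    x^(b s - D) generates O(D) there.  The form g restricts to the pure tensor
    (g / x^(b s)) (x) x^(b s - D).  On a common face the regular function
    a = x^(b s - b t) can be moved across the tensor sign, which turns the tensor
    for s into the one for t. *)
Lemma vanishing_cox_ideal (R : realType) n r (X : fan R n r)
    (Z : closed_subscheme X) D (g : coxring R r) :
    (forall s, s \in cones X -> exists2 b, of_class X D b & nonvanishing b s) ->
  vanishing_form Z D g -> cox_ideal Z g.
Proof.
move=> bpf [gD gZ].
have [b bP] : {b : {set 'I_r} -> 'X_{1..r} & forall s, s \in cones X ->
    of_class X D (b s) /\ nonvanishing (b s) s}.
  apply: (@choice _ _ (fun s b => s \in cones X ->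
    of_class X D b /\ nonvanishing b s)) => s.
  have [sX|sX] := boolP (s \in cones X); last by exists 0%MM.
  by have [b bD bs] := bpf s sX; exists b.
have gE d :
    lmon R (mdivisor d - D) * coord_pullback d g = lmon R (- D) * tofrac g.
  rewrite /coord_pullback addrC lmonD lmon_mdivisor -mulrA; congr (_ * _).
  by rewrite mulrC divfK // tofracX_neq0.
exists [:: (D, lmon R (- D) * tofrac g)]; split; last by rewrite big_seq1 lmonK.
move=> _ /[!inE] /eqP-> /=.
pose w s := [:: (coord_pullback (b s) g, lmon R (mdivisor (b s) - D))].
exists w; last first.
  by move=> s sX; rewrite big_seq1 /= [RHS]mulrC gE.
have secD (s t : {set 'I_r}) :
    s \in cones X -> (forall i, i \in t -> i \in s) ->
    sections X D t (lmon R (mdivisor (b s) - D)).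
  move=> sX ts; have [[m mE] bs] := bP s sX.
  rewrite mE addrC addKr; apply: sections_chi => i it.
  by rewrite -mE mxE (bs i) // ts.
split=> [s sX _ /[!inE] /eqP->|s t sX tface] /=.
  by have [bD bs] := bP s sX; split; [exact: gZ | exact: secD].
have tX := face_cones sX tface; have ts i := face_sub (i := i) tface.
have [[m mE] bs] := bP s sX; have [[m' m'E] bt] := bP t tX.
have dE : mdivisor (b s) - mdivisor (b t) = divchi (rays X) (m - m').
  by rewrite divchiD divchiN mE m'E opprD addrACA subrr add0r.
pose a := lmon R (mdivisor (b s) - mdivisor (b t)).
rewrite /w.
have -> : lmon R (mdivisor (b s) - D) = a * lmon R (mdivisor (b t) - D).
  by rewrite -lmonD addrA subrK.
have -> : coord_pullback (b t) g = a * coord_pullback (b s) g.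
  rewrite /coord_pullback /a lmonBX lmon_mdivisor mulrAC.
  by rewrite [tofrac 'X_[b s] * _]mulrC divfK ?tofracX_neq0.
apply: teq_sym; apply: teq_scale; last exact: secD.
  rewrite /a dE; apply: sections_chi => i it.
  by rewrite -dE add0r !mxE (bs i (ts i it)) (bt i it).
by apply: gZ => //; [exists m | move=> i /ts; apply: bs].
Qed.

Lemma pairing_inhomogeneous (R : realType) n r (X : fan R n r) D E
    (g F : coxring R r) :
  homogeneous X D g -> homogeneous X E F -> ~ lin_equiv X D E ->
  pairing g F = 0.
Proof.
move=> gD FE nDE; rewrite pairingE big_seq big1 // => a /gD aD.
have [/FE aE|/memN_msupp_eq0->] := boolP (a \in msupp F); last by rewrite mulr0.
by case: nDE; apply: lin_equiv_trans aD (lin_equiv_sym aE).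
Qed.

Lemma cox_ideal_contract (R : realType) n r (X : fan R n r)
    (Z : closed_subscheme X) D (F g : coxring R r) : homogeneous X D F ->
    (forall h, vanishing_form Z D h -> pairing h F = 0) ->
  cox_ideal Z g -> contract g F = 0.
Proof.
move=> FD FZ [l [lZ gE]].
have [G GP] : {G : 'rV[int]_r * coxfrac R r -> coxring R r &
    forall p, p \in l ->
    homogeneous X p.1 (G p) /\ tofrac (G p) = lmon R p.1 * p.2}.
  apply: (@choice _ _ (fun p h => p \in l ->
    homogeneous X p.1 h /\ tofrac h = lmon R p.1 * p.2)) => p.
  have [pl|pl] := boolP (p \in l); last by exists 0.
  by have [G GD GE] := H0_image_global (lZ p pl); exists G.
have -> : g = \sum_(p <- l) G p.
  apply/eqP; rewrite -tofrac_eq gE rmorph_sum /=; apply/eqP.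
  by rewrite big_seq [RHS]big_seq; apply: eq_bigr => p /GP[].
apply/mpolyP => c; rewrite mcoeff0 contract_pairing mulr_sumr pairing_suml.
rewrite big_seq big1 // => p pl; have [GD GE] := GP p pl.
have [Dp|nDp] := pselect (lin_equiv X D (mdivisor c + p.1)).
  by apply: FZ; apply: H0_image_vanishing (lZ p pl) GD GE Dp.
apply: (pairing_inhomogeneous (homogeneousMX (c := c) GD) FD) => Dp.
by apply: nDp; rewrite addrC; apply: lin_equiv_sym.
Qed.

Theorem theorem1p1 (R : realType) (n r : nat) (X : fan R n r)
    (hQfact : simplicial X) (hproj : projective X)
    (alpha : 'rV[int]_r) (hPic : cartier X alpha) (hva : very_ample X alpha)
    (F : coxring R r) (hF : homogeneous X alpha F) (hF0 : F != 0)
    (Z : closed_subscheme X) :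
  in_span alpha Z F <->
  (forall g : coxring R r, cox_ideal Z g -> contract g F = 0).
Proof.
have [Xc _] := hproj; have [bpf _] := hva.
apply: (iff_trans (in_spanP Z Xc hF)); split=> [FZ g|FZ g gZ].
  exact: cox_ideal_contract FZ.
by rewrite /pairing (FZ g (vanishing_cox_ideal bpf gZ)) mcoeff0.
Qed.
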